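(* For every real number $q\notin\{0,1,2\}$, the quantity $|\mathsf{S}^{\mathrm{pl}}_n(q)|$ grows exponentially in $n$. Moreover, the following lower bounds hold: \[ |\mathsf{S}^{\mathrm{pl}}_n(q)| \;\ge\; \begin{cases} 2^{(n-2)/2}, & q<0,\\[4pt] 2^{n/8 - o(n)}, & 0 < q < 2,\\[4pt] \sqrt{F_{n-2}}= \Theta(\varphi^{(n-2)/2}), & q>2, \end{cases} \] where $(F_k)_k$ is the Fibonacci sequence ($F_1=F_2=1$), $\varphi=(1+\sqrt5)/2$ is the golden ratio, and the $o(n)$ term is as $n\to\infty$.
   Context: For a finite graph $G$, $P_G(x)$ denotes its chromatic polynomial (the unique polynomial with $P_G(k)$ equal to the number of proper $k$-colorings of $G$ for every positive integer $k$). For a real number $q$ and integer $n\ge1$, $\mathsf{S}^{\mathrm{pl}}_n(q)\coloneqq\{P_G(q): G \text{ a simple planar graph on } n \text{ vertices}\}$, the set of distinct values of $P_G(q)$ over all $n$-vertex simple planar graphs. *)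

(* Defs.v *)
From HB Require Import structures.
From mathcomp Require Import all_boot all_order all_algebra.
From mathcomp Require Import finmap.
From mathcomp Require Import all_classical all_reals all_analysis.

Set Implicit Arguments.
Unset Strict Implicit.
Unset Printing Implicit Defensive.

Import Order.TTheory GRing.Theory Num.Theory.
Import numFieldNormedType.Exports.

Local Open Scope classical_set_scope.
Local Open Scope ring_scope.

Definition simple_graph (n : nat) (e : rel 'I_n) : Prop :=
  symmetric e /\ irreflexive e.

(* Edges are the pairs u < v related by e, so each undirected edge is drawn    *)
(* exactly once; the values of [arc] at other pairs are irrelevant.            *)
Record plane_drawing (R : realType) (n : nat) (e : rel 'I_n)
    (pos : 'I_n -> R * R) (arc : 'I_n -> 'I_n -> R -> R * R) : Prop := {
  drawing_pos_inj : injective pos;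
  drawing_arc_continuous : forall u v : 'I_n, (u < v)%N -> e u v ->
    {within `[0, 1]%classic, continuous (arc u v)};
  drawing_arc_inj : forall u v : 'I_n, (u < v)%N -> e u v ->
    {in `[0, 1] &, injective (arc u v)};
  drawing_arc0 : forall u v : 'I_n, (u < v)%N -> e u v -> arc u v 0 = pos u;
  drawing_arc1 : forall u v : 'I_n, (u < v)%N -> e u v -> arc u v 1 = pos v;
  drawing_arc_vertex : forall u v w : 'I_n, (u < v)%N -> e u v ->
    {in `]0, 1[, forall t, arc u v t <> pos w};
  drawing_arc_arc : forall u v u' v' : 'I_n,
    (u < v)%N -> e u v -> (u' < v')%N -> e u' v' -> (u, v) <> (u', v') ->
    {in `]0, 1[ &, forall s t, arc u v s <> arc u' v' t} }.

Definition planar (R : realType) (n : nat) (e : rel 'I_n) : Prop :=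
  exists pos arc, @plane_drawing R n e pos arc.

Definition proper_coloring (n : nat) (e : rel 'I_n) (k : nat)
    (f : {ffun 'I_n -> 'I_k}) : bool :=
  [forall u, forall v, e u v ==> (f u != f v)].

Definition num_colorings (n : nat) (e : rel 'I_n) (k : nat) : nat :=
  #|[pred f : {ffun 'I_n -> 'I_k} | proper_coloring e f]|.

Definition is_chromatic_poly (R : realType) (n : nat) (e : rel 'I_n)
    (p : {poly R}) : Prop :=
  forall k : nat, (0 < k)%N -> p.[k%:R] = (num_colorings e k)%:R.

Definition chromatic_poly (R : realType) (n : nat) (e : rel 'I_n) : {poly R} :=
  xget 0 [set p | is_chromatic_poly e p].

Definition Spl (R : realType) (n : nat) (q : R) : set R :=
  [set x | exists e : rel 'I_n,
     [/\ simple_graph e, planar R e & x = (chromatic_poly R e).[q]]].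

(* The finite set of values is turned into a finset to be counted; [fset_set]  *)
(* is meaningful here by [finite_Spl] below.                                   *)
Definition card_Spl (R : realType) (n : nat) (q : R) : nat :=
  #|` fset_set (Spl n q)|%fset.

Definition exponential_growth (R : realType) (u : nat -> R) : Prop :=
  exists2 c : R, 1 < c & \forall n \near \oo, c ^+ n <= u n.

Fixpoint fib (k : nat) : nat :=
  match k with
  | 0 => 0
  | k'.+1 => match k' with 0 => 1 | k''.+1 => fib k' + fib k'' end
  end.

Definition golden_ratio (R : realType) : R := (1 + Num.sqrt 5) / 2.

Section WellDefined.
Variables (R : realType) (n : nat) (e : rel 'I_n).

Lemma is_chromatic_poly_unique (p p' : {poly R}) :
  is_chromatic_poly e p -> is_chromatic_poly e p' -> p = p'.
Proof.
move=> hp hp'; apply/eqP; rewrite -subr_eq0; apply: contraT => nz.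
pose s : seq R := [seq i.+1%:R | i <- iota 0 (size (p - p'))].
have := @max_poly_roots R (p - p') s nz.
rewrite size_map size_iota ltnn; apply.
  apply/allP => _ /mapP[i _ ->].
  by rewrite /root hornerD hornerN hp // hp' // subrr.
by rewrite map_inj_uniq ?iota_uniq // => i j /eqP; rewrite eqr_nat => /eqP[].
Qed.

Let img k (f : {ffun 'I_n -> 'I_k}) : {set 'I_k} := (f @: [set: 'I_n])%SET.

Let surj k : nat :=
  #|[set f : {ffun 'I_n -> 'I_k} |
     proper_coloring e f && (img f == [set: 'I_k])]%SET|.

Let card_img k (A : {set 'I_k}) :
  #|[set f : {ffun 'I_n -> 'I_k} | proper_coloring e f && (img f == A)]%SET|
  = surj #|A|.
Proof.
pose g (f : {ffun 'I_n -> 'I_#|A|}) : {ffun 'I_n -> 'I_k} :=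
  [ffun u => enum_val (f u)].
have gI : injective g.
  move=> f1 f2 /ffunP E; apply/ffunP => u.
  by have := E u; rewrite !ffunE => /enum_val_inj.
rewrite /surj -(card_imset _ gI); apply: eq_card => f; rewrite !inE.
have gp h : proper_coloring e (g h) = proper_coloring e h.
  apply: eq_forallb => u; apply: eq_forallb => v.
  by rewrite !ffunE (inj_eq enum_val_inj).
apply/andP/imsetP => [[pf /eqP fA]|[h]].
  have fin u : f u \in A by rewrite -fA; apply/imsetP; exists u; rewrite ?inE.
  pose h : {ffun 'I_n -> 'I_#|A|} := [ffun u => enum_rank_in (fin u) (f u)].
  have gh : g h = f.
    by apply/ffunP => u; rewrite !ffunE enum_rankK_in.
  exists h => //; rewrite inE -gp gh pf /=; apply/eqP/setP => j; rewrite inE.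
  have : enum_val j \in img f by rewrite fA enum_valP.
  case/imsetP => u _ ju; apply/imsetP; exists u; rewrite ?inE //.
  by apply: enum_val_inj; rewrite ju -[in LHS]gh ffunE.
rewrite inE => /andP[ph /eqP hT] ->; rewrite gp; split=> //.
apply/eqP/setP => x; apply/imsetP/idP => [[u _ ->]|xA].
  by rewrite ffunE enum_valP.
have : enum_rank_in xA x \in img h by rewrite hT inE.
by case/imsetP => u _ E; exists u; rewrite ?inE // ffunE -E enum_rankK_in.
Qed.

Lemma num_colorings_bin k :
  num_colorings e k = (\sum_(j < n.+1) 'C(k, j) * surj j)%N.
Proof.
have cardle (f : {ffun 'I_n -> 'I_k}) : (#|img f| < n.+1)%N.
  by rewrite ltnS (leq_trans (leq_imset_card _ _)) // cardsT card_ord.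
rewrite /num_colorings -sum1_card.
rewrite (partition_big (fun f => inord #|img f| : 'I_n.+1) predT) //=.
apply: eq_bigr => j _.
rewrite -[k in 'C(k, _)]card_ord -card_draws -sum_nat_const.
rewrite (partition_big (@img k)
  (mem [set A : {set 'I_k} | #|A| == j]%SET)) /=; last first.
  move=> f /andP[_ /eqP <-]; rewrite inE.
  by rewrite inordK.
apply: eq_bigr => A; rewrite inE => /eqP Aj.
rewrite -Aj -card_img sum1_card; apply: eq_card => f.
rewrite unfold_in /= !inE; case: (proper_coloring e f) => //=.
case: (img f =P A) => [fA|]; rewrite ?andbF // andbT.
by apply/eqP/val_inj; rewrite /= inordK // fA.
Qed.

Lemma is_chromatic_poly_exists : exists p : {poly R}, is_chromatic_poly e p.
Proof.
exists (\sum_(j < n.+1)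
  ((surj j)%:R / (j`!)%:R) *: \prod_(i < j) ('X - i%:R%:P)) => k _.
rewrite num_colorings_bin horner_sum natr_sum; apply: eq_bigr => j _.
have fj : (j`!)%:R != 0 :> R by rewrite pnatr_eq0 -lt0n fact_gt0.
rewrite hornerZ horner_prod.
suff -> : \prod_(i < j) ('X - i%:R%:P).[k%:R] = ('C(k, j) * j`!)%:R :> R.
  by rewrite !natrM mulrCA divfK.
rewrite bin_ffact ffact_prod.
have [kj|jk] := ltnP k j.
  rewrite (bigD1 (Ordinal kj)) //= !hornerE subrr mul0r.
  by rewrite (bigD1 (Ordinal kj)) //= subnn mul0n.
rewrite natr_prod; apply: eq_bigr => i _.
by rewrite !hornerE natrB // ltnW // (leq_trans (ltn_ord i)).
Qed.

Lemma chromatic_polyP : is_chromatic_poly e (chromatic_poly R e).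
Proof. by have [p hp] := is_chromatic_poly_exists; exact: (xgetI 0 hp). Qed.

End WellDefined.

Lemma finite_Spl (R : realType) (n : nat) (q : R) : finite_set (Spl n q).
Proof.
pose val (g : {ffun 'I_n * 'I_n -> bool}) :=
  (chromatic_poly R (fun u v => g (u, v))).[q].
apply: (@sub_finite_set _ _ (range val)); last exact: finite_image.
move=> _ [e [_ _ ->]]; exists [ffun uv => e uv.1 uv.2] => //.
rewrite /val; congr (chromatic_poly R _).[q].
by apply/funext => u; apply/funext => v; rewrite ffunE.
Qed.

(* Main.v *)
Require Import Defs.
From mathcomp Require Import all_boot all_order all_algebra.
From mathcomp Require Import finmap.
From mathcomp Require Import all_classical all_reals all_analysis.
From mathcomp Require Import zify ring lra.

Import Order.TTheory GRing.Theory Num.Theory.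
Import numFieldNormedType.Exports.

Local Open Scope classical_set_scope.
Local Open Scope ring_scope.

(* Let s (resp. d) count the q-colourings of a graph in which two terminals    *)
(* receive prescribed equal (resp. distinct) colours. Putting a path of length *)
(* 2 or 3 in parallel with the graph, or appending an edge to it in series,    *)
(* acts linearly on (s, d), hence by a Moebius map on r = s / d:               *)
(*   r |-> (q-1)/(q-2) r,  r |-> (q-1)(q-2)/(q-1+(q-2)^2) r,                   *)
(*   r |-> (q-1)/(r+q-2).                                                      *)
(* For every q there are two words in these moves that map some interval into  *)
(* disjoint subintervals (ping-pong), so that distinct products yield distinct *)
(* pairs (s, d). As (s, d) is determined by the chromatic polynomials          *)
(* q s + q (q-1) d of the graph and q (q-1) d of the graph with its terminals  *)
(* joined, the number of pairs is at most the square of the number of values.  *)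

Set Implicit Arguments.
Unset Strict Implicit.
Unset Printing Implicit Defensive.

(** * Book embeddings *)

(** All graphs used grow from two isolated terminals, for which s = d = 1. A series edge or a
    parallel path of length 2 costs one vertex, a path of length 3 costs two, and all three moves
    keep a two-page drawing ([planar_book]). The pair (s, d) is recovered from two values of
    chromatic polynomials of planar graphs on the same vertices, so N distinct pairs force at least
    sqrt N values ([size_le_card_Spl]); this is where the exponents get halved. Distinct words give
    distinct pairs because disjoint intervals for the ratio reveal the last move made, and that
    move, an injective linear map, can then be undone ([word_inj], [pingpong_card]). For q < 1 two
    moves of cost 1 give 2^(n-2) words ([card_Spl_lt1]); for q > 2 moves of cost 1 and 2 give a
    Fibonacci number of words ([card_Spl_gt2]); for 1 < q < 2 two words of cost 4 give about 2^(n/4)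
    ([card_Spl_1_2]). *)

Definition crossing (u v u' v' : nat) : bool := [&& u < u', u' < v & v < v']%N.

(** Two intervals that share an inner point and do not cross are nested; as they differ in at least
    one end, the parabola over the wider one lies strictly above the other. *)
Lemma nested_parabolas (R : realType) (u v u' v' : nat) (x : R) :
  (u, v) <> (u', v') -> ~~ crossing u v u' v' -> ~~ crossing u' v' u v ->
  u%:R < x < v%:R -> u'%:R < x < v'%:R ->
  (x - u%:R) * (v%:R - x) <> (x - u'%:R) * (v'%:R - x).
Proof.
move=> neq nc nc' /andP[ux xv] /andP[ux' xv'].
have uv' : (u < v')%N by rewrite -(ltr_nat R) (lt_trans ux).
have uv : (u' < v)%N by rewrite -(ltr_nat R) (lt_trans ux').
have nest (a b c d : nat) : (a, b) <> (c, d) -> (a <= c)%N -> (d <= b)%N ->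
    c%:R < x < d%:R -> (x - c%:R) * (d%:R - x) < (x - a%:R) * (b%:R - x).
  move=> ne ac db /andP[cx xd].
  have ac' : a%:R <= c%:R :> R by rewrite ler_nat.
  have db' : d%:R <= b%:R :> R by rewrite ler_nat.
  have [Ea|Na] := eqVneq a c; last first.
    have : a%:R < c%:R :> R by rewrite ltr_nat ltn_neqAle Na.
    nra.
  have : d%:R < b%:R :> R.
    rewrite ltr_nat ltn_neqAle db andbT; apply/eqP => E.
    by apply: ne; rewrite E Ea.
  nra.
have h : (u <= u' /\ v' <= v)%N \/ (u' <= u /\ v <= v')%N.
  by move: nc nc' uv uv'; rewrite /crossing; lia.
case: h => -[hu hv] E.
  by have := nest _ _ _ _ neq hu hv; rewrite E ux' xv' ltxx => /(_ isT).
have neq' : (u', v') <> (u, v) by move=> F; apply: neq.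
by have := nest _ _ _ _ neq' hu hv; rewrite E ux xv ltxx => /(_ isT).
Qed.

(* A two-page book embedding is a plane drawing: the spine is the x-axis, and  *)
(* the two pages are the half-planes, in which edges are drawn as parabolas.   *)
Lemma planar_book (R : realType) (n : nat) (e : rel 'I_n)
    (page : 'I_n -> 'I_n -> bool) :
  (forall u v u' v' : 'I_n, (u < v)%N -> e u v -> (u' < v')%N -> e u' v' ->
     page u v = page u' v' -> ~~ crossing u v u' v') ->
  planar R e.
Proof.
move=> nocross.
pose x (u v : 'I_n) (t : R) : R := u%:R + t * (v%:R - u%:R).
pose y (u v : 'I_n) (t : R) : R :=
  (-1) ^+ page u v * ((x u v t - u%:R) * (v%:R - x u v t)).
have lt_uv (u v : 'I_n) : (u < v)%N -> 0 < v%:R - u%:R :> R.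
  by move=> uv; rewrite subr_gt0 ltr_nat.
have xI (u v : 'I_n) t : (u < v)%N -> t \in `]0, 1[ -> u%:R < x u v t < v%:R.
  move=> /lt_uv h; rewrite in_itv /= /x => /andP[t0 t1]; apply/andP; split; nra.
have sgn0 (b : bool) : (-1) ^+ b != 0 :> R by rewrite signr_eq0.
exists (fun i => (i%:R, 0)), (fun u v t => (x u v t, y u v t)); split.
- by move=> u v [] /eqP; rewrite eqr_nat => /eqP /val_inj.
- move=> u v _ _; apply: continuous_subspaceT => t.
  have cx : {for t, continuous (x u v)}.
    apply: cvgD; first exact: cvg_cst.
    by apply: cvgM; [exact: cvg_id | exact: cvg_cst].
  have cy : {for t, continuous (y u v)}.
    apply: cvgM; first exact: cvg_cst.
    by apply: cvgM; apply: cvgB => //; exact: cvg_cst.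
  exact: (cvg_pair cx cy).
- move=> u v /lt_uv h _ s t _ _ [] /addrI /mulIf E _; apply: E.
  by rewrite gt_eqF.
- by move=> u v uv _; rewrite /y /x mul0r addr0 subrr mul0r mulr0.
- move=> u v uv _; rewrite /y /x mul1r subrKC subrr !mulr0 //.
- move=> u v w uv _ t /(xI _ _ _ uv) /andP[h1 h2] [_] /eqP.
  rewrite mulf_eq0 (negbTE (sgn0 _)) /= => /eqP; nra.
- move=> u v u' v' uv euv uv' euv' neq s t /(xI _ _ _ uv) h /(xI _ _ _ uv') h'.
  case=> Ex; rewrite /y -Ex => Ey; rewrite -Ex in h'.
  have [pE|pN] := eqVneq (page u v) (page u' v').
    move: Ey; rewrite pE => /(mulfI (sgn0 _)); apply: nested_parabolas => //.
    + by move=> [/val_inj Eu /val_inj Ev]; apply: neq; rewrite Eu Ev.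
    + exact: nocross.
    + exact: nocross.
  (* On different pages the two heights are nonzero and have opposite signs. *)
  move: h h' => /andP[h1 h2] /andP[h3 h4].
  have p1 : 0 < (x u v s - u%:R) * (v%:R - x u v s) by rewrite mulr_gt0 ?subr_gt0.
  have p2 : 0 < (x u v s - u'%:R) * (v'%:R - x u v s) by rewrite mulr_gt0 ?subr_gt0.
  move: pN Ey; case: (page u v); case: (page u' v') => //= _;
    rewrite ?expr1 ?expr0 !mulN1r !mul1r; lra.
Qed.

(** Graphs are built on [nat], each edge stored once in increasing order, so that adding a vertex
    needs no transport between ordinal types. *)
Definition graph_below (n : nat) (E : rel nat) : Prop :=
  forall u v, E u v -> (u < v < n)%N.

Definition sym_rel (n : nat) (E : rel nat) : rel 'I_n :=
  fun u v => E u v || E v u.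
Arguments sym_rel n E : clear implicits.

(* One page holds the edges at vertex 0, the other page the remaining edges.   *)
Definition book_graph (E : rel nat) : Prop :=
  forall u v u' v', E u v -> E u' v' -> (0 < u)%N -> ~~ crossing u v u' v'.

(** On the page without vertex 0 no edge arches over [t], so an edge from [t] to a new vertex at the
    right end of the spine can be drawn there. *)
Definition visible (E : rel nat) (t : nat) : Prop :=
  (0 < t)%N /\ forall u v, E u v -> (0 < u)%N -> ~~ (u < t < v)%N.

(** With [p] the second terminal, [apex] = true puts a path of length 2 in parallel, and [apex] =
    false appends an edge in series. One step of each kind in turn produces the path of length 3. *)
Definition add_vertex (E : rel nat) (n p : nat) (apex : bool) : rel nat :=
  fun u v => E u v || (v == n) && ((u == p) || apex && (u == 0)).

(** Joining the terminals discards the colourings with equal end colours, which isolates [d]. *)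
Definition add_edge0 (E : rel nat) (t : nat) : rel nat :=
  fun u v => E u v || (u == 0) && (v == t).

Section Drawing.
Variables (E : rel nat) (n : nat).
Hypotheses (En : graph_below n E) (Eb : book_graph E).

Lemma graph_below_add_vertex p apex :
  (p < n)%N -> graph_below n.+1 (add_vertex E n p apex).
Proof.
move=> pn u v /orP[/En|/andP[/eqP-> /orP[/eqP->|/andP[_ /eqP->]]]]; lia.
Qed.

Lemma graph_below_add_edge0 t :
  (0 < t < n)%N -> graph_below n (add_edge0 E t).
Proof. by move=> tn u v /orP[/En|/andP[/eqP-> /eqP->]]. Qed.

Lemma book_add_vertex p apex :
  visible E p -> book_graph (add_vertex E n p apex).
Proof.
move=> [p0 pv] u v u' v' e e' u0; rewrite /crossing; apply/negP => /and3P[uu' u'v vv'].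
case/orP: e => [e|/andP[/eqP ve _]]; last first.
  by case/orP: e' => [/En|/andP[/eqP]]; lia.
case/orP: e' => [e'|/andP[/eqP v'e /orP[/eqP u'e|/andP[_ /eqP]]]]; last by lia.
  by have /negP := Eb e e' u0; rewrite /crossing uu' u'v vv'.
by have /negP := pv _ _ e u0; rewrite -u'e uu' u'v.
Qed.

Lemma book_add_edge0 t : book_graph (add_edge0 E t).
Proof.
move=> u v u' v' /orP[e|/andP[/eqP->]] // /orP[e'|/andP[/eqP-> _]] u0.
  exact: Eb.
by rewrite /crossing; lia.
Qed.

Lemma visible_add_vertex p apex t :
  visible E t -> (t <= p)%N -> visible (add_vertex E n p apex) t.
Proof.
move=> [t0 tv] tp; split=> // u v /orP[e|/andP[_ /orP[/eqP->|/andP[_ /eqP->]]]] u0 //.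
  exact: tv.
by lia.
Qed.

Lemma visible_new p apex : (0 < n)%N -> visible (add_vertex E n p apex) n.
Proof. by move=> n0; split=> // u v /orP[/En|/andP[/eqP->]]; lia. Qed.

Lemma simple_sym_rel : simple_graph (sym_rel n E).
Proof.
split=> [u v|u]; first by rewrite /sym_rel orbC.
by apply/negP; rewrite /sym_rel orbb => /En; rewrite ltnn.
Qed.

Lemma planar_sym_rel (R : realType) : planar R (sym_rel n E).
Proof.
apply: (@planar_book _ _ _ (fun u _ => u == 0 :> nat)) => u v u' v'.
move=> uv /orP[e|/En]; last by lia.
move=> uv' /orP[e'|/En]; last by lia.
case: eqP => [->|u0] /esym /eqP h; last by apply: Eb => //; lia.
by rewrite /crossing; lia.
Qed.

End Drawing.

(** * Counting colourings by the colours of the terminals *)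

Section Coloring.
Variables (k : nat) (R : comNzRingType).
Local Notation colorings n := {ffun 'I_n -> 'I_k.+1}.

(* Colourings read as functions on nat, extended by a junk colour beyond n.    *)
Definition color n (f : colorings n) (i : nat) : 'I_k.+1 :=
  if insub i is Some j then f j else ord0.

Definition extend n (f : colorings n) (c : 'I_k.+1) : colorings n.+1 :=
  [ffun i => if insub (val i) is Some j then f j else c].

Lemma color_ord n (f : colorings n) (i : 'I_n) : color f i = f i.
Proof. by rewrite /color valK. Qed.

Lemma color_extend n (f : colorings n) c i :
  (i < n)%N -> color (extend f c) i = color f i.
Proof.
move=> lt_in; have lt_inS : (i < n.+1)%N by rewrite ltnW.
by rewrite -[LHS]/(color _ (Ordinal lt_inS)) color_ord ffunE /color /= insubT.
Qed.

Lemma color_extend_new n (f : colorings n) c : color (extend f c) n = c.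
Proof.
rewrite -[LHS]/(color _ (@ord_max n)) color_ord ffunE /= insubF //.
by rewrite ltnn.
Qed.

Lemma sum_extend n (F : colorings n.+1 -> R) :
  \sum_g F g = \sum_f \sum_c F (extend f c).
Proof.
rewrite pair_big /=.
rewrite (reindex (fun fc : colorings n * 'I_k.+1 => extend fc.1 fc.2)) //=.
exists (fun g : colorings n.+1 => ([ffun i => color g (val i)], color g n)).
  move=> [f c] _ /=; rewrite color_extend_new; congr (_, _).
  by apply/ffunP => i; rewrite ffunE color_extend // color_ord.
move=> g _; apply/ffunP => i; rewrite ffunE /=.
case: insubP => [j _ ji|]; first by rewrite ffunE ji color_ord.
rewrite -leqNgt => ni; rewrite -[RHS]color_ord; congr color.
by apply/eqP; rewrite eqn_leq ni -ltnS ltn_ord.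
Qed.

Lemma proper_coloringP (E : rel nat) n (f : colorings n) :
  graph_below n E ->
  reflect (forall u v, E u v -> color f u != color f v)
    (proper_coloring (sym_rel n E) f).
Proof.
move=> En; apply: (iffP forallP) => [h u v e|h u].
  have /andP[uv vn] := En _ _ e; have un := ltn_trans uv vn.
  have /forallP/(_ (Ordinal vn))/implyP := h (Ordinal un).
  by rewrite -!color_ord /= => -> //; rewrite /sym_rel e.
apply/forallP => v; apply/implyP; rewrite -!color_ord => /orP[/h //|/h].
by rewrite eq_sym.
Qed.

Lemma proper_extend (E : rel nat) n p apex (f : colorings n) c :
  graph_below n E -> (0 < p < n)%N ->
  proper_coloring (sym_rel n.+1 (add_vertex E n p apex)) (extend f c) =
  proper_coloring (sym_rel n E) f &&
    ((c != color f p) && (apex ==> (c != color f 0))).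
Proof.
move=> En /andP[p0 pn].
have En1 : graph_below n.+1 (add_vertex E n p apex) by exact: graph_below_add_vertex.
apply/idP/idP => [/(proper_coloringP _ En1) h|].
  apply/and3P; split.
  - apply/(proper_coloringP _ En) => u v e; have := En _ _ e => /andP[uv vn].
    rewrite -(color_extend f c) ?(ltn_trans uv) // -(color_extend f c vn).
    by apply: h; rewrite /add_vertex e.
  - rewrite eq_sym -(color_extend f c) // -[c in _ != c](color_extend_new f c).
    by apply: h; rewrite /add_vertex !eqxx orbT.
  - apply/implyP => ha.
    rewrite eq_sym -(color_extend f c) ?(ltn_trans p0) //.
    rewrite -[c in _ != c](color_extend_new f c).
    by apply: h; rewrite /add_vertex ha !eqxx !orbT.
case/and3P => /(proper_coloringP _ En) h h1 /implyP h2.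
apply/(proper_coloringP _ En1) => u v /orP[e|].
  have /andP[uv vn] := En _ _ e.
  by rewrite !color_extend // ?(ltn_trans uv) //; exact: h.
case/andP => /eqP-> /orP[/eqP->|/andP[/h2 ha /eqP->]].
  by rewrite color_extend_new color_extend // eq_sym.
by rewrite color_extend_new color_extend ?(ltn_trans p0) // eq_sym.
Qed.

Lemma sum_add_vertex (E : rel nat) n p apex (F : colorings n.+1 -> R) :
  graph_below n E -> (0 < p < n)%N ->
  \sum_(g | proper_coloring (sym_rel n.+1 (add_vertex E n p apex)) g) F g =
  \sum_(f | proper_coloring (sym_rel n E) f)
    \sum_(c | (c != color f p) && (apex ==> (c != color f 0))) F (extend f c).
Proof.
move=> En pn; rewrite big_mkcond sum_extend [RHS]big_mkcond.
apply: eq_bigr => f _; under eq_bigr do rewrite proper_extend //.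
by case: proper_coloring => /=; [rewrite [RHS]big_mkcond | rewrite big1].
Qed.

(** Testing against an arbitrary [phi] turns each move on graphs into its adjoint on [phi]: the
    colours of the new vertices are summed out inside the test function. *)
Definition end_sum (s d : R) (phi : 'I_k.+1 -> 'I_k.+1 -> R) : R :=
  \sum_x \sum_y (if x == y then s else d) * phi x y.

(* [s] (resp. [d]) is the number of proper colourings in which the vertices 0  *)
(* and [t] receive prescribed equal (resp. distinct) colours.                  *)
Definition end_count (n : nat) (E : rel nat) (t : nat) (s d : R) : Prop :=
  forall phi : 'I_k.+1 -> 'I_k.+1 -> R,
    \sum_(f : colorings n | proper_coloring (sym_rel n E) f)
      phi (color f 0) (color f t) = end_sum s d phi.

Local Notation K := (k.+1%:R : R).

Lemma sum_if_eq (s d : R) (x : 'I_k.+1) :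
  \sum_y (if x == y then s else d) = s + (K - 1) * d.
Proof.
rewrite (bigD1 x) //= eqxx (eq_bigr (fun=> d)) => [|y /negbTE]; last first.
  by rewrite eq_sym => ->.
rewrite sumr_const cardC1 card_ord /= -[d *+ _]mulr_natl; congr (_ + _ * _).
by rewrite -[k.+1%:R]natr1 addrK.
Qed.

Lemma sum_avoid1 (s d : R) (x c : 'I_k.+1) :
  \sum_(y | y != c) (if x == y then s else d) =
  if x == c then (K - 1) * d else s + (K - 2) * d.
Proof.
have := sum_if_eq s d x; rewrite (bigD1 c) //= => /(canRL (addKr _)) ->.
by case: eqP => _; ring.
Qed.

Lemma sum_avoid2 (a : R) (x y : 'I_k.+1) :
  \sum_(c | (c != y) && (c != x)) a = (if x == y then K - 1 else K - 2) * a.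
Proof.
(* Giving weight 0 to the colour [x] encodes the second avoidance condition. *)
have := sum_avoid1 0 a x y.
rewrite big_mkcond [X in X = _ -> _](eq_bigr
  (fun c => if (c != y) && (c != x) then a else 0)) => [|c _]; last first.
  by rewrite [c == x]eq_sym; case: eqP => //=; case: eqP.
by rewrite -big_mkcond add0r => ->; case: eqP.
Qed.

Lemma end_sum_parallel2 s d phi :
  end_sum s d (fun x y => \sum_(c | (c != y) && (c != x)) phi x y) =
  end_sum ((K - 1) * s) ((K - 2) * d) phi.
Proof.
apply: eq_bigr => x _; apply: eq_bigr => y _; rewrite sum_avoid2.
by case: eqP => _; ring.
Qed.

(** The new colour [c] becomes the end colour and the old one, [y], is summed out over y != c. If c
    = x, all K - 1 choices differ from [x]; otherwise one choice equals [x] and K - 2 differ from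
    it. *)
Lemma end_sum_series s d phi :
  end_sum s d (fun x y => \sum_(c | c != y) phi x c) =
  end_sum ((K - 1) * d) (s + (K - 2) * d) phi.
Proof.
apply: eq_bigr => x _.
under eq_bigr do rewrite mulr_sumr.
rewrite (exchange_big_dep predT) //=; apply: eq_bigr => c _.
rewrite -mulr_suml; congr (_ * _); rewrite -sum_avoid1.
by apply: eq_bigl => y; rewrite eq_sym.
Qed.

(** For equal ends the inner colours of the path can be chosen in (K - 1)(K - 2) ways. For distinct
    ends, c = x leaves K - 1 choices for [c'], and each of the K - 2 other values of [c] leaves K -
    2. *)
Lemma end_sum_parallel3 s d phi :
  end_sum s d (fun x y =>
    \sum_(c | c != y) \sum_(c' | (c' != c) && (c' != x)) phi x y) =
  end_sum ((K - 1) * (K - 2) * s) (((K - 1) + (K - 2) ^+ 2) * d) phi.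
Proof.
apply: eq_bigr => x _; apply: eq_bigr => y _.
under eq_bigr do rewrite sum_avoid2.
rewrite -mulr_suml sum_avoid1.
by case: eqP => _; ring.
Qed.

Lemma end_count_two : end_count 2 (fun _ _ => false) 1 1 1.
Proof.
move=> phi; rewrite /end_sum (eq_bigl predT) => [|f]; last first.
  by apply/forallP => u; apply/forallP.
rewrite !sum_extend.
have sum0 (F : colorings 0 -> R) : \sum_f F f = F [ffun=> ord0].
  rewrite (big_pred1 [ffun=> ord0]) // => f; apply/esym/eqP/ffunP; case=> //.
rewrite sum0; apply: eq_bigr => x _; apply: eq_bigr => y _.
by rewrite if_same mul1r color_extend // !color_extend_new.
Qed.

Section Operations.
Variables (n : nat) (E : rel nat) (t : nat) (s d : R).
Hypotheses (En : graph_below n E) (tn : (0 < t < n)%N)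
  (Ec : end_count n E t s d).

Let n0 : (0 < n)%N. Proof. by case: n tn => //; rewrite andbF. Qed.
Let t_n : (t < n)%N. Proof. by case/andP: tn. Qed.

Lemma end_count_parallel2 :
  end_count n.+1 (add_vertex E n t true) t ((K - 1) * s) ((K - 2) * d).
Proof.
move=> phi; rewrite sum_add_vertex // -end_sum_parallel2 -Ec.
by apply: eq_bigr => f _; apply: eq_bigr => c _; rewrite !color_extend.
Qed.

Lemma end_count_series :
  end_count n.+1 (add_vertex E n t false) n ((K - 1) * d) (s + (K - 2) * d).
Proof.
move=> phi; rewrite sum_add_vertex // -end_sum_series -Ec.
apply: eq_bigr => f _; apply: eq_big => [c|c _]; first by rewrite andbT.
by rewrite color_extend // color_extend_new.
Qed.

Lemma end_count_parallel3 :
  end_count n.+2 (add_vertex (add_vertex E n t false) n.+1 n true) t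
    ((K - 1) * (K - 2) * s) (((K - 1) + (K - 2) ^+ 2) * d).
Proof.
move=> phi; rewrite sum_add_vertex ?n0 ?leqnn //; last first.
  exact: graph_below_add_vertex.
rewrite sum_add_vertex // -end_sum_parallel3 -Ec.
apply: eq_bigr => f _; apply: eq_big => [c|c _]; first by rewrite andbT.
rewrite color_extend_new color_extend //; apply: eq_bigr => c' _.
by rewrite !color_extend // ltnW.
Qed.

Lemma num_colorings_end :
  (num_colorings (sym_rel n E) k.+1)%:R = K * s + K * (K - 1) * d.
Proof.
rewrite /num_colorings -sum1_card natr_sum.
transitivity (end_sum s d (fun _ _ => 1)); first by rewrite -Ec.
rewrite /end_sum (eq_bigr (fun=> s + (K - 1) * d)) => [|x _].
  by rewrite sumr_const card_ord -[_ *+ k.+1]mulr_natl; ring.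
by under eq_bigr do rewrite mulr1; rewrite sum_if_eq.
Qed.

Lemma num_colorings_add_edge0 :
  (num_colorings (sym_rel n (add_edge0 E t)) k.+1)%:R = K * (K - 1) * d.
Proof.
have Et := graph_below_add_edge0 En tn.
rewrite /num_colorings -sum1_card natr_sum.
transitivity (end_sum s d (fun x y => if x == y then 0 else 1)).
  rewrite -Ec big_mkcond [RHS]big_mkcond; apply: eq_bigr => f _.
  have pE : proper_coloring (sym_rel n (add_edge0 E t)) f =
      proper_coloring (sym_rel n E) f && (color f 0 != color f t).
    apply/idP/andP => [/(proper_coloringP _ Et) h|].
      split; last by apply: h; rewrite /add_edge0 !eqxx orbT.
      by apply/(proper_coloringP _ En) => u v e; apply: h; rewrite /add_edge0 e.
    case=> /(proper_coloringP _ En) h h0.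
    by apply/(proper_coloringP _ Et) => u v /orP[/h //|/andP[/eqP-> /eqP->]].
  by rewrite unfold_in /= pE; case: proper_coloring => //=; case: eqP.
rewrite /end_sum (eq_bigr (fun=> (K - 1) * d)) => [|x _].
  by rewrite sumr_const card_ord -[_ *+ k.+1]mulr_natl; ring.
rewrite -[RHS]add0r -(sum_if_eq 0 d x); apply: eq_bigr => y _.
by case: eqP => _; rewrite ?mulr0 ?mulr1.
Qed.

End Operations.
End Coloring.

(** * Values of chromatic polynomials of planar graphs *)

Section Realizable.
Variable R : realType.
Implicit Types (n : nat) (s d : {poly R}) (q : R) (x : R * R).

(** One graph serves all numbers of colours, and [s], [d] are polynomials that interpolate its
    counts at the positive integers; they can therefore be evaluated at a real [q]. *)
Definition realizable n s d : Prop :=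
  exists E t, [/\ graph_below n E, book_graph E, visible E t, (t < n)%N &
    forall k, @end_count k R n E t s.[k.+1%:R] d.[k.+1%:R]].

Lemma realizable_two : realizable 2 1 1.
Proof.
exists (fun _ _ => false), 1%N; split=> // k; rewrite hornerC.
exact: end_count_two.
Qed.

Lemma realizable_parallel2 n s d :
  realizable n s d -> realizable n.+1 (('X - 1%:P) * s) (('X - 2%:P) * d).
Proof.
move=> [E [t [En Eb tv tn Ec]]]; have t0 := tv.1.
exists (add_vertex E n t true), t; split.
- exact: graph_below_add_vertex.
- exact: book_add_vertex.
- exact: visible_add_vertex.
- exact: ltnW.
- move=> k; rewrite !hornerM !hornerXsubC.
  by apply: end_count_parallel2 => //; rewrite t0.
Qed.

Lemma realizable_series_edge n s d :
  realizable n s d ->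
  realizable n.+1 (('X - 1%:P) * d) (s + ('X - 2%:P) * d).
Proof.
move=> [E [t [En Eb tv tn Ec]]]; have t0 := tv.1.
exists (add_vertex E n t false), n; split=> //.
- exact: graph_below_add_vertex.
- exact: book_add_vertex.
- by apply: visible_new => //; apply: leq_ltn_trans tn.
- move=> k; rewrite hornerD !hornerM !hornerXsubC.
  by apply: end_count_series => //; rewrite t0.
Qed.

Lemma realizable_parallel3 n s d :
  realizable n s d ->
  realizable n.+2 (('X - 1%:P) * ('X - 2%:P) * s)
    ((('X - 1%:P) + ('X - 2%:P) ^+ 2) * d).
Proof.
move=> [E [t [En Eb tv tn Ec]]]; have t0 := tv.1.
have n0 : (0 < n)%N by apply: leq_ltn_trans tn.
have En1 : graph_below n.+1 (add_vertex E n t false) by exact: graph_below_add_vertex.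
exists (add_vertex (add_vertex E n t false) n.+1 n true), t; split.
- exact: graph_below_add_vertex.
- apply: book_add_vertex => //; first exact: book_add_vertex.
  exact: visible_new.
- by apply: visible_add_vertex; [exact: visible_add_vertex | exact: ltnW].
- by apply: ltnW; apply: ltnW.
- move=> k; rewrite !hornerE.
  by apply: end_count_parallel3 => //; rewrite t0.
Qed.

Lemma chromatic_poly_eq n (e : rel 'I_n) (p : {poly R}) :
  (forall k, p.[k.+1%:R] = (num_colorings e k.+1)%:R) -> chromatic_poly R e = p.
Proof.
move=> h; apply: is_chromatic_poly_unique (chromatic_polyP R e) _.
by case=> // k _; apply: h.
Qed.

Lemma realizable_Spl n s d q :
  realizable n s d ->
  Spl n q (q * s.[q] + q * (q - 1) * d.[q]) /\ Spl n q (q * (q - 1) * d.[q]).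
Proof.
move=> [E [t [En Eb tv tn Ec]]]; have t0n : (0 < t < n)%N by rewrite tv.1.
split.
  exists (sym_rel n E); split; [exact: simple_sym_rel|exact: planar_sym_rel|].
  rewrite (@chromatic_poly_eq _ _ ('X * s + 'X * ('X - 1%:P) * d)).
    by rewrite !hornerE.
  by move=> k; rewrite (num_colorings_end (Ec k)) !hornerE.
have Et := graph_below_add_edge0 En t0n.
exists (sym_rel n (add_edge0 E t)); split.
- exact: simple_sym_rel.
- by apply: planar_sym_rel => //; exact: book_add_edge0.
rewrite (@chromatic_poly_eq _ _ ('X * ('X - 1%:P) * d)); first by rewrite !hornerE.
by move=> k; rewrite (num_colorings_add_edge0 En t0n (Ec k)) !hornerE.
Qed.

Definition attained n q x : Prop :=
  exists s d, realizable n s d /\ x = (s.[q], d.[q]).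

Definition parallel2 q x : R * R := ((q - 1) * x.1, (q - 2) * x.2).
Definition series_edge q x : R * R := ((q - 1) * x.2, x.1 + (q - 2) * x.2).
Definition parallel3 q x : R * R :=
  ((q - 1) * (q - 2) * x.1, ((q - 1) + (q - 2) ^+ 2) * x.2).

Lemma attained_two q : attained 2 q (1, 1).
Proof. by exists 1, 1; split; [exact: realizable_two | rewrite !hornerE]. Qed.

Lemma attained_parallel2 n q x : attained n q x -> attained n.+1 q (parallel2 q x).
Proof.
move=> [s [d [/realizable_parallel2 r ->]]].
by eexists; eexists; split; [exact: r | rewrite /= !hornerE].
Qed.

Lemma attained_series_edge n q x : attained n q x -> attained n.+1 q (series_edge q x).
Proof.
move=> [s [d [/realizable_series_edge r ->]]].
by eexists; eexists; split; [exact: r | rewrite /= !hornerE].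
Qed.

Lemma attained_parallel3 n q x : attained n q x -> attained n.+2 q (parallel3 q x).
Proof.
move=> [s [d [/realizable_parallel3 r ->]]].
by eexists; eexists; split; [exact: r | rewrite /= !hornerE].
Qed.

(** The map [h] sends (s, d) to the values at [q] for the graph and for the graph with its terminals
    joined. It is injective as q (q - 1) != 0, and it lands in the square of the set of values. *)
Lemma size_le_card_Spl n q (W : seq (R * R)) :
  q != 0 -> q != 1 -> uniq W -> (forall x, x \in W -> attained n q x) ->
  (size W <= card_Spl n q ^ 2)%N.
Proof.
move=> q0 q1 Wu Wa; set A := fset_set (Spl n q).
pose h x := (q * x.1 + q * (q - 1) * x.2, q * (q - 1) * x.2).
have h_inj : injective h.
  have q1' : q * (q - 1) != 0 by rewrite mulf_neq0 // subr_eq0.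
  move=> [a b] [a' b'] /= [] /[swap] /(mulfI q1') -> /addIr /(mulfI q0) -> //.
rewrite -(size_map h) expnSr expn1 -[X in (_ <= X)%N](size_allpairs pair A A).
apply: uniq_leq_size; first by rewrite map_inj_uniq.
move=> _ /mapP[x /Wa [s [d [r ->]]] ->].
have [s1 s2] := realizable_Spl q r.
by apply: allpairs_f; rewrite in_fset_set; [exact/mem_set| exact: finite_Spl |
  exact/mem_set | exact: finite_Spl].
Qed.

End Realizable.

(** * Ping-pong *)

Section PingPong.
Variables (T : Type) (D : T -> Prop) (act : bool -> T -> T) (wt : bool -> nat).
Hypothesis act_stable : forall b x, D x -> D (act b x).
Hypothesis act_inj : forall b b' x y,
  D x -> D y -> act b x = act b' y -> b = b' /\ x = y.
Hypothesis wt_gt0 : forall b, (0 < wt b)%N.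

Lemma word_stable x w : D x -> D (foldr act x w).
Proof. by move=> Dx; elim: w => //= b w IH; apply: act_stable. Qed.

(** The outermost letters agree and can be cancelled. Equal total weight, with positive letters,
    excludes the remaining case of a nonempty word that fixes [x], compared with the empty word. *)
Lemma word_inj x w w' : D x ->
  sumn (map wt w) = sumn (map wt w') -> foldr act x w = foldr act x w' -> w = w'.
Proof.
move=> Dx; elim: w w' => [|b w IH] [|b' w'] //=.
- by move: (wt_gt0 b'); case: (wt b').
- by move: (wt_gt0 b); case: (wt b).
move=> ws /act_inj [||bb ww]; [exact: word_stable|exact: word_stable|].
by move: ws; rewrite bb => /addnI /IH ->.
Qed.

End PingPong.

(** These are the compositions of [n] into parts 1 ([false]) and 2 ([true]). *)
Fixpoint fib_words (n : nat) : seq (seq bool) :=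
  match n with
  | 0 => [:: [::]]
  | n'.+1 => match n' with
    | 0 => [:: [:: false]]
    | n''.+1 => map (cons false) (fib_words n') ++ map (cons true) (fib_words n'')
    end
  end.

Lemma fib_wordsP n :
  [/\ uniq (fib_words n), size (fib_words n) = fib n.+1 &
    forall w, w \in fib_words n -> sumn (map (fun b => if b then 2 else 1)%N w) = n].
Proof.
have cons_inj (b : bool) : injective (cons b) by move=> u v [].
suff [] : [/\ uniq (fib_words n), size (fib_words n) = fib n.+1 &
    forall w, w \in fib_words n -> sumn (map (fun b => if b then 2 else 1)%N w) = n]
  /\ [/\ uniq (fib_words n.+1), size (fib_words n.+1) = fib n.+2 &
    forall w, w \in fib_words n.+1 ->
      sumn (map (fun b => if b then 2 else 1)%N w) = n.+1] by [].
elim: n => [|n [[u0 s0 w0] [u1 s1 w1]]].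
  by split; split=> // w; rewrite inE => /eqP ->.
split=> //; split.
- rewrite /= -/(fib_words n.+1) cat_uniq !map_inj_uniq // u0 u1 andbT /=.
  by apply/hasPn => _ /mapP[w _ ->]; apply/negP => /mapP[w' _ []].
- by rewrite /= -/(fib_words n.+1) size_cat !size_map s0 s1.
- move=> w; rewrite /= -/(fib_words n.+1) mem_cat.
  by case/orP => /mapP[w' h ->] /=; rewrite ?(w0 _ h) ?(w1 _ h).
Qed.

Lemma uniform_words (c n : nat) : exists W : seq (seq bool),
  [/\ uniq W, size W = (2 ^ n)%N &
    forall w, w \in W -> sumn (map (fun=> c) w) = (c * n)%N].
Proof.
exists (map val (enum {: n.-tuple bool})); split.
- by rewrite (map_inj_uniq val_inj) enum_uniq.
- by rewrite size_map -cardE card_tuple card_bool.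
- move=> _ /mapP[w _ ->]; rewrite -[X in (c * X)%N](size_tuple w) /=.
  by elim: (val w) => [|b v IH] /=; rewrite ?muln0 // mulnS IH.
Qed.

(** * Moebius dynamics of the ratio s / d in the three ranges of q *)

Section Ratio.
Variable R : realType.
Implicit Types (n : nat) (q : R) (x y : R * R) (I : R -> Prop).

(** Since division by 0 returns 0, the nonvanishing of the second coordinate has to be carried
    along. *)
Definition ratio_in I x : Prop := x.2 != 0 /\ I (x.1 / x.2).

(** This and the next two lemmas are phrased as preconditions, so that words of several moves are
    treated by chaining them backwards. *)
Lemma ratio_parallel2 I q x : q != 2 ->
  ratio_in (fun r => I ((q - 1) / (q - 2) * r)) x -> ratio_in I (parallel2 q x).
Proof.
rewrite -subr_eq0 => q2 [x2 Ix]; split; first by rewrite mulf_neq0.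
by move: Ix; rewrite /= mulf_div.
Qed.

Lemma ratio_series_edge I q x :
  ratio_in (fun r => r + (q - 2) != 0 /\ I ((q - 1) / (r + (q - 2)))) x ->
  ratio_in I (series_edge q x).
Proof.
move=> [x2 [r0 Ix]].
have E : x.1 + (q - 2) * x.2 = x.2 * (x.1 / x.2 + (q - 2)) by field.
split; rewrite /= E; first by rewrite mulf_neq0.
by rewrite [_ * x.2]mulrC -mulf_div divff // mul1r.
Qed.

Lemma ratio_parallel3 I q x : (q - 1) + (q - 2) ^+ 2 != 0 ->
  ratio_in (fun r => I ((q - 1) * (q - 2) / ((q - 1) + (q - 2) ^+ 2) * r)) x ->
  ratio_in I (parallel3 q x).
Proof.
move=> q3 [x2 Ix]; split; first by rewrite mulf_neq0.
by move: Ix; rewrite /= mulf_div.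
Qed.

Lemma ratio_inW I J x : (forall r, I r -> J r) -> ratio_in I x -> ratio_in J x.
Proof. by move=> IJ [x2 Ix]; split=> //; apply: IJ. Qed.

Lemma parallel2_inj q : q != 1 -> q != 2 -> injective (parallel2 q).
Proof.
rewrite -subr_eq0 -[q == 2]subr_eq0 => q1 q2 [a b] [a' b'] [].
by move=> /(mulfI q1) -> /(mulfI q2) ->.
Qed.

Lemma series_edge_inj q : q != 1 -> injective (series_edge q).
Proof.
rewrite -subr_eq0 => q1 [a b] [a' b'] [] /= /(mulfI q1) -> /addIr ->.
by [].
Qed.

Lemma iter_inj (T : Type) (f : T -> T) m : injective f -> injective (iter m f).
Proof. by move=> fI; elim: m => [|m IH] x y //= /fI /IH. Qed.

Lemma parallel3_inj q : q != 1 -> q != 2 -> (q - 1) + (q - 2) ^+ 2 != 0 ->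
  injective (parallel3 q).
Proof.
rewrite -subr_eq0 -[q == 2]subr_eq0 => q1 q2 q3 [a b] [a' b'] [].
by move=> /(mulfI (mulf_neq0 q1 q2)) -> /(mulfI q3) ->.
Qed.

Lemma attained_iter_series_edge n q x m :
  attained n q x -> attained (m + n) q (iter m (series_edge q) x).
Proof. by move=> nx; elim: m => //= m IH; apply: attained_series_edge. Qed.

(** The number [m] is a padding: series edges appended after the word adjust the number of vertices.
    They act injectively on pairs, so the padded ratio need not stay in [I]. *)
Lemma pingpong_card q (I : R -> Prop) (J : bool -> R -> Prop)
    (act : bool -> R * R -> R * R) (wt : bool -> nat) n x :
  q != 0 -> q != 1 ->
  (forall b, injective (act b)) ->
  (forall b y, ratio_in I y -> ratio_in (J b) (act b y)) ->
  (forall b r, J b r -> I r) ->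
  (forall r, J true r -> J false r -> False) ->
  (forall b, (0 < wt b)%N) ->
  (forall b m y, attained m q y -> attained (wt b + m) q (act b y)) ->
  ratio_in I x -> attained n q x ->
  forall (W : seq (seq bool)) N m, uniq W ->
    (forall w, w \in W -> sumn (map wt w) = N) ->
    (size W <= card_Spl (m + (N + n)) q ^ 2)%N.
Proof.
move=> q0 q1 act_inj actJ JI Jdisj wt0 act_att Ix nx W N m Wu WN.
have stable b y : ratio_in I y -> ratio_in I (act b y).
  by move=> /(actJ b); apply: ratio_inW; exact: JI.
have inj b b' y z : ratio_in I y -> ratio_in I z -> act b y = act b' z ->
    b = b' /\ y = z.
  move=> Iy Iz E; suff bb : b = b' by split=> //; apply: (act_inj b'); rewrite -E bb.
  have := actJ b y Iy; have := actJ b' z Iz; rewrite -E => -[_ +] [_ +].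
  by case: b b' {E} => -[] // j1 j2; exfalso; eauto.
have w_att w : attained (sumn (map wt w) + n) q (foldr act x w).
  by elim: w => //= b w IH; rewrite -addnA; exact: act_att.
rewrite -(size_map (fun w => iter m (series_edge q) (foldr act x w))).
apply: size_le_card_Spl => //.
  rewrite map_inj_in_uniq // => w w' /WN wN /WN w'N.
  move=> /(iter_inj (series_edge_inj q1)).
  by apply: (word_inj stable inj wt0 Ix); rewrite wN w'N.
move=> _ /mapP[w /WN wN ->]; apply: attained_iter_series_edge.
by rewrite -wN.
Qed.

(** Put c = (1 - q)/(2 - q), which lies in ]0, 1[. The parallel path multiplies the ratio by c and
    maps ]0, 1] onto ]0, c]; the series edge, r |-> (1 - q)/(2 - q - r), is increasing there and
    lands in ]c, 1]. *)
Lemma card_Spl_lt1 n q : q < 1 -> q != 0 -> (2 ^ n <= card_Spl n.+2 q ^ 2)%N.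
Proof.
move=> q1 q0.
pose act b := if b then parallel2 q else series_edge q.
pose J (b : bool) (r : R) := if b then 0 < r <= (1 - q) / (2 - q)
  else (1 - q) / (2 - q) < r <= 1.
have q2 : q != 2 by apply/eqP; lra.
have q1' : q != 1 by rewrite lt_eqF.
have p2 : 0 < 2 - q by lra.
have [k0 k1] : 0 < (1 - q) / (2 - q) /\ (1 - q) / (2 - q) < 1.
  by split; [apply: divr_gt0 | rewrite ltr_pdivrMr //]; lra.
have [W [Wu <- WN]] := uniform_words 1 n.
have -> : n.+2 = (0 + (1 * n + 2))%N by lia.
apply: (@pingpong_card q (fun r => 0 < r <= 1) J act (fun=> 1%N) 2 (1, 1)) => //.
- by case; [exact: parallel2_inj | exact: series_edge_inj].
- case=> y /= Iy.
    apply: ratio_parallel2 => //; apply: ratio_inW Iy => r /andP[r0 r1] /=.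
    have -> : (q - 1) / (q - 2) = (1 - q) / (2 - q) by rewrite -mulrNN -invrN !opprB.
    by apply/andP; split; nra.
  apply: ratio_series_edge; apply: ratio_inW Iy => r /andP[r0 r1] /=.
  have rq : 0 < 2 - q - r by lra.
  have -> : r + (q - 2) = - (2 - q - r) by ring.
  split; first by rewrite oppr_eq0 gt_eqF.
  have -> : (q - 1) / - (2 - q - r) = (1 - q) / (2 - q - r).
    by rewrite -mulrNN -invrN opprK opprB.
  rewrite ler_pdivrMr // ltr_pM2l ?subr_gt0 // ltf_pV2 ?posrE //.
  by apply/andP; split; lra.
- by case=> r /andP[] /=; lra.
- by move=> r /andP[? ?] /andP[]; lra.
- by case=> m y; [exact: attained_parallel2 | exact: attained_series_edge].
- by split; rewrite /= ?oner_eq0 // divr1 ltr01 lexx.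
- exact: attained_two.
Qed.

(** On [1, oo[ the parallel path multiplies the ratio by c = (q - 1)/(q - 2) > 1. One series edge
    leads into ]0, 1], and a second one returns to [1, c[; hence the letters of weight 1 and 2. *)
Lemma card_Spl_gt2 n q : 2 < q -> (fib n.+1 <= card_Spl n.+2 q ^ 2)%N.
Proof.
move=> q2.
pose act b := if b then iter 2 (series_edge q) else parallel2 q.
pose J (b : bool) (r : R) := if b then 1 <= r < (q - 1) / (q - 2)
  else (q - 1) / (q - 2) <= r.
have q0 : q != 0 by apply/eqP; lra.
have q1' : q != 1 by apply/eqP; lra.
have q2' : q != 2 by apply/eqP; lra.
have p2 : 0 < q - 2 by lra.
have p1 : 0 < q - 1 by lra.
have k1 : 1 < (q - 1) / (q - 2) by rewrite ltr_pdivlMr //; lra.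
have [Wu <- WN] := fib_wordsP n.
have -> : n.+2 = (0 + (n + 2))%N by lia.
apply: (@pingpong_card q (fun r => 1 <= r) J act
  (fun b => if b then 2 else 1)%N 2 (1, 1)) => //.
- by case; [apply: iter_inj; exact: series_edge_inj | exact: parallel2_inj].
- case=> y /= Iy; last first.
    apply: ratio_parallel2 => //; apply: ratio_inW Iy => r r1 /=; nra.
  apply: ratio_series_edge; apply: ratio_series_edge; apply: ratio_inW Iy => r r1 /=.
  have r0 : 0 < r + (q - 2) by lra.
  have s0 : 0 < (q - 1) / (r + (q - 2)) by rewrite divr_gt0.
  have s1 : (q - 1) / (r + (q - 2)) <= 1 by rewrite ler_pdivrMr //; lra.
  split; first by rewrite gt_eqF.
  move: ((q - 1) / _) s0 s1 => s s0 s1; have sq : 0 < s + (q - 2) by lra.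
  split; first by rewrite gt_eqF.
  rewrite ler_pdivlMr // ltr_pM2l // ltf_pV2 ?posrE //.
  by apply/andP; split; lra.
- by case=> r /=; [case/andP | lra].
- by move=> r /andP[? ?]; rewrite /J; lra.
- by case.
- case=> m y; last exact: attained_parallel2.
  by move=> ?; do 2!apply: attained_series_edge.
- by split; rewrite /= ?oner_eq0 // divr1.
- exact: attained_two.
Qed.

(** Here a path of length 2 multiplies the ratio by -k, and [k] may exceed 1, so it need not
    contract. Two paths of length 3 multiply it by t^2 < 1 and serve instead. They cost 4 vertices;
    one series edge would already land in [J false], and four are taken only to equalize the
    weights. *)
Lemma card_Spl_1_2 n m q : 1 < q < 2 -> (2 ^ n <= card_Spl (m + (4 * n + 3)) q ^ 2)%N.
Proof.
move=> /andP[q1 q2].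
pose act b := if b then iter 2 (parallel3 q) else iter 4 (series_edge q).
(* The starting ratio, after one path of length 2, is -k, and -t is the factor of [parallel3]. *)
pose k := (q - 1) / (2 - q); pose g := (q - 1) + (q - 2) ^+ 2.
pose t := (q - 1) * (2 - q) / g.
pose J (b : bool) (r : R) := if b then - t < r < 0 else - k <= r <= - t.
have q0 : q != 0 by apply/eqP; lra.
have q1' : q != 1 by apply/eqP; lra.
have q2' : q != 2 by apply/eqP; lra.
have p2 : 0 < 2 - q by lra.
have p1 : 0 < q - 1 by lra.
have g0 : 0 < g by rewrite /g; nra.
have k0 : 0 < k by rewrite divr_gt0.
have t0 : 0 < t by rewrite divr_gt0 // mulr_gt0.
have t1 : t < 1 by rewrite ltr_pdivrMr // /g; nra.
(* This makes two applications of [parallel3] contract [-k, 0[ into ]-t, 0[.   *)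
have tk1 : t * k < 1.
  have -> : t * k = (q - 1) ^+ 2 / g.
    by rewrite /t /k; field; rewrite !gt_eqF.
  by rewrite ltr_pdivrMr // /g; nra.
have tk : t < k.
  rewrite /t /k ltr_pdivrMr // mulrAC ltr_pdivlMr // -mulrA ltr_pM2l //.
  by rewrite /g; nra.
(* The series edge sends -k to -t, so the same [t] bounds both image intervals. *)
have tE : (q - 1) / (k + (2 - q)) = t.
  rewrite /t /k /g; field.
  by rewrite -/g !gt_eqF.
have Jser y : ratio_in (fun r => - k <= r < 0) y ->
    ratio_in (J false) (series_edge q y).
  move=> Iy; apply: ratio_series_edge; apply: ratio_inW Iy => r /andP[r0 r1] /=.
  have rq : 0 < 2 - q - r by lra.
  have -> : r + (q - 2) = - (2 - q - r) by ring.
  split; first by rewrite oppr_eq0 gt_eqF.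
  rewrite invrN mulrN !lerN2; apply/andP; split; [rewrite /k | rewrite -tE].
    by rewrite ler_pM2l // lef_pV2 ?posrE //; lra.
  by rewrite ler_pM2l // lef_pV2 ?posrE //; lra.
have JI b r : J b r -> - k <= r < 0.
  by case: b => /andP[? ?]; apply/andP; split; lra.
have [W [Wu <- WN]] := uniform_words 4 n.
apply: (@pingpong_card q (fun r => - k <= r < 0) J act (fun=> 4%N) 3
  (parallel2 q (1, 1))) => //.
- case; apply: iter_inj; last exact: series_edge_inj.
  by apply: parallel3_inj => //; rewrite gt_eqF.
- case=> y Iy; last first.
    by do 3!(apply/Jser; apply: (ratio_inW (JI false))); exact: Jser.
  do 2!(apply: ratio_parallel3; first by rewrite gt_eqF).
  apply: ratio_inW Iy => r /andP[r0 r1].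
  have -> : (q - 1) * (q - 2) / (q - 1 + (q - 2) ^+ 2) = - t.
    by rewrite /t -mulNr -mulrN opprB.
  have tt : 0 < t * t by nra.
  by rewrite /J mulrA mulrNN; apply/andP; split; nra.
- by move=> r /andP[? ?] /andP[]; lra.
- case=> p y h; first exact: attained_parallel3 (attained_parallel3 h).
  exact: (attained_iter_series_edge 4 h).
- apply: ratio_parallel2 => //; split; rewrite /= ?oner_eq0 // divr1 mulr1.
  have -> : (q - 1) / (q - 2) = - k by rewrite /k -mulrN -invrN opprB.
  by rewrite lexx; lra.
- by apply: attained_parallel2; exact: attained_two.
Qed.

End Ratio.

(** * Asymptotics *)

Section Asymptotics.
Variable R : realType.
Implicit Types (n m : nat) (q : R).

Lemma card_Spl_gt0 n q : (0 < card_Spl n q)%N.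
Proof.
pose e : rel 'I_n := fun _ _ => false.
have : Spl n q (chromatic_poly R e).[q].
  exists e; split=> //.
  by apply: (@planar_book _ _ _ (fun _ _ => true)).
rewrite -(fset_setK (finite_Spl n q)) => h.
by rewrite /card_Spl cardfs_gt0; apply/fset0Pn; exists (chromatic_poly R e).[q].
Qed.

Lemma sqrt_natr_le (a b : nat) :
  (a <= b ^ 2)%N -> Num.sqrt a%:R <= b%:R :> R.
Proof.
move=> ab; have <- : Num.sqrt (b%:R ^+ 2) = b%:R :> R.
  by rewrite sqrtr_sqr ger0_norm.
by rewrite ler_sqrt ?sqr_ge0 // -natrX ler_nat.
Qed.

Lemma powR_half (a x : R) : a `^ (x / 2) = Num.sqrt (a `^ x).
Proof. by rewrite powRrM powR12_sqrt // powR_ge0. Qed.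

Lemma powR2_half_le (x : R) (a b : nat) :
  (2 ^ a <= b ^ 2)%N -> x <= a%:R -> 2 `^ (x / 2) <= b%:R :> R.
Proof.
move=> /sqrt_natr_le ab xa; apply: le_trans ab.
rewrite powR_half ler_sqrt // natrX -powR_mulrn ?ler0n //.
by apply: ler_powR => //; rewrite ler1n.
Qed.

Lemma card_Spl_exp2_lt1 n q : q < 1 -> q != 0 -> (1 <= n)%N ->
  2 `^ ((n%:R - 2) / 2) <= (card_Spl n q)%:R :> R.
Proof.
move=> q1 q0; case: n => [|[|n]] // _.
  by apply: (@powR2_half_le _ 0); rewrite ?expn_gt0 ?card_Spl_gt0 //; lra.
apply: powR2_half_le (card_Spl_lt1 n q1 q0) _.
by rewrite -[n.+2]addn2 natrD addrK.
Qed.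

Lemma exp2_le_fib n : (2 ^ n./2 <= fib n.+1)%N.
Proof.
suff [] : (2 ^ n./2 <= fib n.+1)%N /\ (2 ^ n.+1./2 <= fib n.+2)%N by [].
elim: n => [|n [h1 h2]] //; split=> //.
rewrite [n.+2./2]/= expnS mul2n -addnn.
rewrite -[fib n.+3]/(fib n.+2 + fib n.+1)%N.
apply: leq_add => //; apply: leq_trans h2; rewrite leq_exp2l //.
by rewrite half_leq.
Qed.

Lemma fib_le n : (fib n <= fib n.+1)%N.
Proof. by case: n => [|n] //=; exact: leq_addr. Qed.

Lemma sqrt_fib_le_card_Spl n q : 2 < q ->
  Num.sqrt (fib (n - 2))%:R <= (card_Spl n q)%:R :> R.
Proof.
move=> q2; apply: sqrt_natr_le.
case: n => [|[|n]] //; rewrite subSS subSS subn0.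
exact: leq_trans (fib_le n) (card_Spl_gt2 n q2).
Qed.

(** A weaker bound valid in all ranges at once; it yields exponential growth and, with the constant
    error term 1, the case 0 < q < 2. *)
Lemma card_Spl_exp2 n q : q != 0 -> q != 1 -> q != 2 -> (1 <= n)%N ->
  2 `^ (n%:R / 8 - 1) <= (card_Spl n q)%:R :> R.
Proof.
move=> q0 q1 q2 n0.
have -> : n%:R / 8 - 1 = (n%:R / 4 - 2) / 2 :> R by field.
(* For such [n] the exponent is negative, and one value is enough. *)
have small : (n <= 2)%N -> 2 `^ ((n%:R / 4 - 2) / 2) <= (card_Spl n q)%:R :> R.
  rewrite -(ler_nat R) => n2.
  by apply: (@powR2_half_le _ 0); rewrite ?expn_gt0 ?card_Spl_gt0 //; lra.
have [/small //|n2] := leqP n 2.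
have n2R : 2 < n%:R :> R by rewrite ltr_nat.
have [q1'|] := ltP q 1.
  apply: le_trans (card_Spl_exp2_lt1 q1' q0 n0).
  by apply: ler_powR; [rewrite ler1n | lra].
rewrite le_eqVlt eq_sym (negbTE q1) /= => q1'.
have [q2'|] := ltP q 2.
  (* Three vertices go to the starting graph, the rest to blocks of 4, and the remainder modulo 4 to
     padding. *)
  have := @card_Spl_1_2 R ((n - 3) %/ 4) ((n - 3) %% 4) q; rewrite q1' q2' => /(_ isT).
  have -> : ((n - 3) %% 4 + (4 * ((n - 3) %/ 4) + 3) = n)%N by lia.
  move=> /powR2_half_le; apply.
  have h : (n <= 4 * ((n - 3) %/ 4) + 6)%N by lia.
  by move: h; rewrite -(ler_nat R) natrD natrM; lra.
rewrite le_eqVlt eq_sym (negbTE q2) /= => q2'.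
have := leq_trans (exp2_le_fib (n - 2)) (card_Spl_gt2 (n - 2) q2').
have -> : (n - 2).+2 = n by lia.
move=> /powR2_half_le; apply.
have h : (n <= 2 * (n - 2)./2 + 3)%N by lia.
by move: h; rewrite -(ler_nat R) natrD natrM; lra.
Qed.

Lemma exponential_growth_exp2 (u : nat -> R) :
  (forall n, (1 <= n)%N -> 2 `^ (n%:R / 8 - 1) <= u n) -> exponential_growth u.
Proof.
(* The base is chosen because n/8 - 1 >= n/16 as soon as n >= 16. *)
move=> hu; exists (2 `^ (16^-1)).
  rewrite lt_neqAle eq_sym powR_eq1 -[leLHS](powRr0 2) ler_powR ?ler1n //.
  by rewrite invr_eq0 !pnatr_eq0 ltrn0 -[1]/(1%:R) eqr_nat.
exists 16%N => // n /= n16; apply: le_trans (hu n _); last by lia.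
rewrite -powR_mulrn ?powR_ge0 // -powRrM; apply: ler_powR; first by rewrite ler1n.
have : 16 <= n%:R :> R by rewrite ler_nat.
lra.
Qed.

(** * Fibonacci numbers and powers of the golden ratio *)

Local Notation phi := (golden_ratio R).

Lemma golden_ratio_sqr : phi ^+ 2 = phi + 1.
Proof.
have s5 : Num.sqrt 5 ^+ 2 = 5 :> R by rewrite sqr_sqrtr.
by rewrite /golden_ratio; move: s5; move: (Num.sqrt 5) => s s5; field: s5.
Qed.

Lemma golden_ratio_ge1 : 1 <= phi.
Proof.
rewrite /golden_ratio ler_pdivlMr // mul1r -lerBlDl.
have -> : 2 - 1 = Num.sqrt 1 :> R by rewrite sqrtr1; ring.
by rewrite ler_sqrt ?ler1n.
Qed.

(** Powers of [phi] obey the Fibonacci recurrence, so both bounds follow by two-step induction from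
    the initial values. *)
Lemma fib_golden_ratio n :
  (fib n)%:R <= phi ^+ n /\ phi ^+ n <= phi * (fib n.+1)%:R.
Proof.
have p1 := golden_ratio_ge1.
suff [] : ((fib n)%:R <= phi ^+ n /\ phi ^+ n <= phi * (fib n.+1)%:R) /\
  ((fib n.+1)%:R <= phi ^+ n.+1 /\ phi ^+ n.+1 <= phi * (fib n.+2)%:R) by [].
elim: n => [|n [[l0 u0] [l1 u1]]].
  by rewrite /= expr0 expr1 !mulr1; do !split => //; lra.
split=> //.
have E : phi ^+ n.+2 = phi ^+ n.+1 + phi ^+ n.
  by rewrite !exprS mulrA -expr2 golden_ratio_sqr; ring.
rewrite -[fib n.+3]/(fib n.+2 + fib n.+1)%N.
have -> : (fib n.+2)%:R = (fib n.+1)%:R + (fib n)%:R :> R by rewrite -natrD.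
rewrite natrD -[fib n.+2]/(fib n.+1 + fib n)%N natrD E; split; first lra.
by move: u1; rewrite -[fib n.+2]/(fib n.+1 + fib n)%N natrD; lra.
Qed.

Lemma sqrt_fib_Theta :
  (fun n : nat => Num.sqrt (fib (n - 2))%:R : R^o) =Theta_\oo
    (fun n : nat => phi `^ ((n%:R - 2) / 2) : R^o).
Proof.
have p1 := golden_ratio_ge1; have p0 : 0 < phi by lra.
rewrite eqThetaE qualifE; apply/asboolP.
(* The lower constant comes from phi^(m+1) <= phi^2 F_(m+1) by taking square roots. The threshold 3
   avoids F_0 = 0, where no positive constant works. *)
exists (phi^-1, 1) => /=; first by rewrite invr_gt0 p0 ltr01.
exists 3%N => // n /= n3.
have -> : n%:R - 2 = (n - 2)%:R :> R by rewrite natrB // ltnW.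
have -> : (n - 2 = (n - 3).+1)%N by lia.
move: (n - 3)%N => m.
rewrite powR_half powR_mulrn ?(ltW p0) // !ger0_norm ?sqrtr_ge0 // mul1r.
have [l u] := fib_golden_ratio m.+1; split; last by rewrite ler_sqrt // exprn_ge0 ?ltW.
have [_ u'] := fib_golden_ratio m.
rewrite ler_pdivrMl // -[X in X * _](@ger0_norm R) ?(ltW p0) // -sqrtr_sqr.
rewrite -sqrtrM ?sqr_ge0 // ler_sqrt ?mulr_ge0 ?sqr_ge0 //.
by rewrite exprS expr2 -mulrA ler_pM2l.
Qed.

End Asymptotics.

Unset Implicit Arguments.

Theorem theorem1p1 (R : realType) :
  (forall q : R, q <> 0 -> q <> 1 -> q <> 2 ->
     [/\ exponential_growth (fun n => (card_Spl n q)%:R : R),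
         q < 0 ->
           forall n : nat, (1 <= n)%N ->
             2 `^ ((n%:R - 2) / 2) <= (card_Spl n q)%:R :> R,
         0 < q < 2 ->
           exists2 err : nat -> R^o,
             err =o_\oo (fun n => n%:R : R^o) &
             forall n : nat, (1 <= n)%N ->
               2 `^ (n%:R / 8 - err n) <= (card_Spl n q)%:R :> R
       & 2 < q ->
           forall n : nat, (1 <= n)%N ->
             Num.sqrt (fib (n - 2))%:R <= (card_Spl n q)%:R :> R])
  /\
  (fun n : nat => Num.sqrt (fib (n - 2))%:R : R^o) =Theta_\oo
    (fun n : nat => golden_ratio R `^ ((n%:R - 2) / 2) : R^o).
Proof.
split; last exact: sqrt_fib_Theta.
move=> q /eqP q0 /eqP q1 /eqP q2; split.
- by apply: exponential_growth_exp2 => n; apply: card_Spl_exp2.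
- by move=> qneg n; apply: card_Spl_exp2_lt1 => //; lra.
- move=> _; exists (fun=> 1) => [|n]; last exact: card_Spl_exp2.
  apply/eqoP => eps eps0; near=> n.
  rewrite normr1 ger0_norm ?ler0n // -ler_pdivrMl // mulr1.
  by near: n; exact: nbhs_infty_ger.
- by move=> q2' n _; apply: sqrt_fib_le_card_Spl.
Unshelve. all: by end_near. Qed.
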